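(* Let $G$ be a graph containing no cycles of length four, and let $a,b: V(G)\rightarrow \mathbf{N}_{\geq 2}$ be two functions. If $$d_G(x)\geq a(x)+b(x)-1$$ for every vertex $x\in V(G)$, then there is a partition $(A,B)$ of $V(G)$ such that $d_A(x)\geq a(x)$ for every $x\in A$, and $d_B(x)\geq b(x)$ for every $x\in B$.
   Context: All graphs are finite and simple, with non-empty vertex set. $\mathbf{N}_{\geq 2}$ denotes the set of integers that are at least two. $d_G(v)$ denotes the degree of $v$ in $G$; for $A\subseteq V(G)$, $d_A(v)$ denotes the number of vertices in $A$ that are adjacent to $v$ in $G$. ''Containing no cycles of length four'' means that $G$ has no (not necessarily induced) subgraph isomorphic to $C_4$. A partition $(A,B)$ of $V(G)$ means two disjoint non-empty sets $A,B$ with $A\cup B=V(G)$. *)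

(* Defs.v *)
From mathcomp Require Import all_boot.

Set Implicit Arguments.
Unset Strict Implicit.
Unset Printing Implicit Defensive.

(* A finite simple graph on the vertex type V is its adjacency relation. *)
Definition simple_graph (V : finType) (e : rel V) : Prop :=
  symmetric e /\ irreflexive e.

Definition degree (V : finType) (e : rel V) (x : V) : nat :=
  #|[set y | e x y]|.

Definition degree_in (V : finType) (e : rel V) (A : {set V}) (x : V) : nat :=
  #|[set y in A | e x y]|.

(* ucycleb e c: the vertices of c are pairwise distinct and cyclically
   consecutive ones are adjacent. Chords are allowed, so a cycle need not be an
   induced subgraph. *)
Definition C4_free (V : finType) (e : rel V) : Prop :=
  forall c : seq V, size c = 4 -> ~~ ucycleb e c.

(* Both parts are required to be non-empty. *)
Definition vertex_partition (V : finType) (A B : {set V}) : Prop :=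
  [/\ A != set0, B != set0, [disjoint A & B] & A :|: B = [set: V]].

(* Main.v *)
Require Import Defs.
From mathcomp Require Import all_boot zify.

Set Implicit Arguments.
Unset Strict Implicit.
Unset Printing Implicit Defensive.

(** Write d_A(x) for the degree of x into A.  Increasing b, one may assume that
    d(x) = a(x) + b(x) - 1 for all x.  Then two disjoint non-empty sets, the
    first a-good (d_S(x) >= a(x) for x in S) and the second b-good, already
    suffice: they grow to a partition, since a vertex with fewer than b(x)
    neighbours outside S has at least a(x) neighbours in S
    ([good_pair_partition]).

    Suppose there is no such pair.  Call a set a-poor if it contains no
    non-empty a-good set.  There are partitions (A, B) with A a-poor and B
    b-poor; take the ones maximising e(A) + e(B) + sum_A b + sum_B a.  Call x in
    A deficient if d_A(x) < a(x), and symmetrically in B; poorness makes both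
    sides have deficient vertices.  Moving a deficient x alone, or a deficient y
    alone, increases the weight, hence creates a good set; as the two good sets
    meet, x and y are adjacent, d_A(x) = a(x) - 1, d_B(y) = b(y) - 1, and
    swapping x and y gives another maximal partition.  These facts are symmetric
    in the two sides, and they are all that is used afterwards
    ([exchange_system], [exchange_system_of_no_good_pair]).

    Every deficient vertex of A is adjacent to every deficient vertex of B, so
    by C4-freeness one side has a single deficient vertex.  If both sides have
    just one, a swap produces a second one on some side.  So let A have at least
    two, and let y be the only deficient vertex of B ([no_two_deficient]).
    Deleting the deficient vertices from the poor set A exposes a tight vertex
    u (d_A(u) = a(u)) with a deficient neighbour x.

    If u is adjacent to y, then x may be exchanged for any tight neighbour v of
    y in B, which keeps y deficient and makes u and v deficient.  By
    C4-freeness the neighbourhood of y induces a matching.  If v has no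
    neighbour in the part of N(y) inside A, the exchange destroys the edge xu
    there and creates none, so one concludes by induction.  Otherwise B contains
    a tight neighbour t of such a v which is not adjacent to y; the exchange
    makes t deficient, and there are two deficient vertices on each side.

    If u is not adjacent to y, then x, y and a tight v in B form a triangle,
    each with a pendant neighbour: a [net].  Swaps permute the net in all ways
    while the rest of the partition stays fixed.  A vertex z of A outside the net
    which is exposed by deleting the net has to see the A-part of the net after
    each of these permutations, which forces z to be adjacent to the three
    pendant vertices ([net_common_neighbour]).  The same holds on the side of B,
    which gives a 4-cycle ([net_false]). *)

(** * Degrees into a set, good sets and poor sets *)

(** Degree counts depend on the numerical hypotheses only. *)
Ltac deg_lia := intros;
  repeat match goal with
  | H : ?T |- _ =>
    lazymatch T with
    | is_true (leq _ _) => fail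
    | @eq _ _ _ => fail
    | _ => clear H
    end
  end; lia.

Definition good (V : finType) (e : rel V) (a : V -> nat) (A : {set V}) : bool :=
  [forall x in A, a x <= degree_in e A x].

Definition poor (V : finType) (e : rel V) (a : V -> nat) (A : {set V}) : bool :=
  [forall S : {set V}, (S \subset A) && (S != set0) ==> ~~ good e a S].

Definition unique_common_nbr (V : finType) (e : rel V) : Prop :=
  forall p q u v : V,
    p != q -> e p u -> e q u -> e p v -> e q v -> u = v.

Section Degrees.

Variables (V : finType) (e : rel V).
Hypothesis e_simple : simple_graph e.

Local Notation dg := (degree_in e).

Lemma adj_sym x y : e x y = e y x.
Proof. by case: e_simple. Qed.

Lemma adj_irr x : e x x = false.
Proof. by case: e_simple. Qed.

Lemma adj_neq x y : e x y -> x != y.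
Proof. by apply: contraTN => /eqP->; rewrite adj_irr. Qed.

Lemma C4_free_unique_common_nbr : C4_free e -> unique_common_nbr e.
Proof.
move=> free p q u v pq pu qu pv qv; apply/eqP/negPn/negP => uv.
have /negP[] := free [:: p; u; q; v] erefl.
rewrite /ucycleb /= !inE pu (adj_sym u) qu qv (adj_sym v) pv /=.
rewrite !negb_or pq uv (adj_neq pu) (adj_neq pv) (adj_neq qv).
by rewrite eq_sym (adj_neq qu).
Qed.

Lemma deg_inS (A B : {set V}) x : A \subset B -> dg A x <= dg B x.
Proof.
move=> /subsetP AB; apply/subset_leq_card/subsetP => y.
by rewrite !inE => /andP[/AB-> ->].
Qed.

Lemma deg_inID (A B : {set V}) x : dg A x = dg (A :&: B) x + dg (A :\: B) x.
Proof.
rewrite /degree_in -(cardsID B [set y in A | e x y]).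
by congr (_ + _); apply: eq_card => y; rewrite !inE; case: (e x y); rewrite ?andbF ?andbT.
Qed.

Lemma deg_in_setC (A : {set V}) x : dg A x + dg (~: A) x = degree e x.
Proof.
rewrite -[degree e x](_ : dg setT x = _); last first.
  by apply: eq_card => y; rewrite !inE.
by rewrite (deg_inID setT A) setTI setTD.
Qed.

Lemma deg_in1 y x : dg [set y] x = e x y.
Proof.
rewrite /degree_in; case xy: (e x y).
  rewrite (_ : [set _ in _ | _] = [set y]) ?cards1 //.
  by apply/setP=> z; rewrite !inE; case: eqP => // ->.
by apply: eq_card0 => z; rewrite !inE; case: eqP => // ->.
Qed.

Lemma deg_in_D1 (A : {set V}) y x : y \in A -> dg A x = e x y + dg (A :\ y) x.
Proof.
by move=> yA; rewrite (deg_inID A [set y]) (setIidPr _) ?sub1set // deg_in1.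
Qed.

Lemma deg_in_U1 (A : {set V}) y x : y \notin A -> dg (y |: A) x = e x y + dg A x.
Proof. by move=> yA; rewrite (@deg_in_D1 _ y) ?setU11 // setU1K. Qed.

Lemma deg_in_swap (A : {set V}) x y u : x \in A -> y \notin A ->
  dg (y |: A :\ x) u + e u x = dg A u + e u y.
Proof.
move=> xA yA; rewrite deg_in_U1 ?(deg_in_D1 u xA); first by lia.
by rewrite !inE (negPf yA) andbF.
Qed.

Lemma deg_in_gt0 (A : {set V}) x : 0 < dg A x -> exists2 y, y \in A & e x y.
Proof. by case/card_gt0P=> y; rewrite inE => /andP[]; exists y. Qed.

Lemma poorP a (A : {set V}) :
  reflect (forall S : {set V}, S \subset A -> S != set0 ->
             exists2 x, x \in S & dg S x < a x)
          (poor e a A).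
Proof.
apply: (iffP forallP) => poorA S.
  move=> SA Sn; have := poorA S; rewrite SA Sn negb_forall_in /=.
  by case/exists_inP=> x xS; rewrite -ltnNge; exists x.
apply/implyP=> /andP[SA Sn]; rewrite negb_forall_in.
by have [x xS lt] := poorA S SA Sn; apply/exists_inP; exists x; rewrite -?ltnNge.
Qed.

Lemma poorS a (A B : {set V}) : A \subset B -> poor e a B -> poor e a A.
Proof.
move=> AB /poorP poorB; apply/poorP => S SA; apply: poorB.
exact: subset_trans AB.
Qed.

(** Deleting from a poor set A a set R of vertices which contains all vertices of
    small degree exposes a vertex t of small degree in what is left.  Its degree
    in A was not small, so it has lost a neighbour; having lost only one, it
    has degree exactly a t in A. *)
Lemma poor_tight_vertex a (A R : {set V}) :
    poor e a A -> A :\: R != set0 ->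
    (forall x, x \in A -> dg A x < a x -> x \in R) ->
    (forall t r s, t \in A :\: R -> r \in A :&: R -> s \in A :&: R ->
       e t r -> e t s -> r = s) ->
  exists t r, [/\ t \in A :\: R, r \in A :&: R, e t r & dg A t = a t].
Proof.
move=> /poorP poorA AR lowR uniqR.
have [t tAR lt_t] := poorA _ (subsetDl A R) AR.
have [tR tA] : t \notin R /\ t \in A by move: tAR; rewrite inE => /andP[].
have ge_t : a t <= dg A t by rewrite leqNgt; apply: contraNN tR => /lowR->.
have /deg_in_gt0[r rAR tr] : 0 < dg (A :&: R) t.
  by move: ge_t; rewrite (deg_inID A R); lia.
have le1 : dg (A :&: R) t <= 1.
  apply/card_le1_eqP => r1 r2 r1S r2S.
  have /andP[r1AR tr1] : (r1 \in A :&: R) && e t r1 by rewrite inE in r1S.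
  have /andP[r2AR tr2] : (r2 \in A :&: R) && e t r2 by rewrite inE in r2S.
  exact: uniqR tAR r2AR r1AR tr2 tr1.
exists t, r; split=> //; move: ge_t; rewrite (deg_inID A R); lia.
Qed.

End Degrees.

(** * Exchange systems *)

Definition deficient (V : finType) (e : rel V) (a : V -> nat) (A : {set V}) (x : V) :=
  (x \in A) && (degree_in e A x < a x).

Definition tight (V : finType) (e : rel V) (a : V -> nat) (A : {set V}) (x : V) :=
  (x \in A) && (degree_in e A x == a x).

(** What is remembered of the extremal partitions.  The conditions are symmetric
    under exchanging the two sides, so every consequence holds for both, and
    [es_swap] allows one to move from one partition of the family to another. *)
Record exchange_system (V : finType) (e : rel V) (a b : V -> nat)
    (P : {set V} -> {set V} -> Prop) : Prop := ExchangeSystem {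
  es_ge2l : forall x, 2 <= a x;
  es_ge2r : forall x, 2 <= b x;
  es_setC : forall A B, P A B -> B = ~: A;
  es_n0l : forall A B, P A B -> A != set0;
  es_n0r : forall A B, P A B -> B != set0;
  es_poorl : forall A B, P A B -> poor e a A;
  es_poorr : forall A B, P A B -> poor e b B;
  es_deg : forall A B x, P A B ->
    degree_in e A x + degree_in e B x + 1 = a x + b x;
  es_swap : forall A B x y, P A B -> deficient e a A x -> deficient e b B y ->
    [/\ e x y, degree_in e A x + 1 = a x, degree_in e B y + 1 = b y
      & P (y |: A :\ x) (x |: B :\ y)] }.

Lemma exchange_system_sym (V : finType) (e : rel V) a b P :
  simple_graph e ->
  exchange_system e a b P -> exchange_system e b a (fun A B => P B A).
Proof.
move=> e_simple ES; split.
- exact: es_ge2r ES.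
- exact: es_ge2l ES.
- by move=> A B /(es_setC ES)->; rewrite setCK.
- by move=> A B /(es_n0r ES).
- by move=> A B /(es_n0l ES).
- by move=> A B /(es_poorr ES).
- by move=> A B /(es_poorl ES).
- by move=> A B x PBA; have := es_deg ES x PBA; deg_lia.
move=> A B x y PBA dx dy; have [xy ? ? ?] := es_swap ES PBA dy dx.
by split=> //; rewrite adj_sym.
Qed.

Section Exchange.

Variables (V : finType) (e : rel V) (a b : V -> nat).
Variable P : {set V} -> {set V} -> Prop.
Hypotheses (e_simple : simple_graph e) (e_uc : unique_common_nbr e).
Hypothesis ES : exchange_system e a b P.

Local Notation dg := (degree_in e).
Local Notation esym := (adj_sym e_simple).
Local Notation lowA := (deficient e a).
Local Notation lowB := (deficient e b).
Local Notation tightA := (tight e a).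
Local Notation tightB := (tight e b).

Section State.

Variables (A B : {set V}).
Hypothesis PAB : P A B.

Lemma state_memr x : (x \in B) = (x \notin A).
Proof. by rewrite (es_setC ES PAB) inE. Qed.

Lemma state_neq x y : x \in A -> y \in B -> x != y.
Proof. by rewrite state_memr => xA; apply: contraNneq => <-. Qed.

Lemma deg_swapl x y u : x \in A -> y \in B ->
  dg (y |: A :\ x) u + e u x = dg A u + e u y.
Proof. by rewrite state_memr; apply: deg_in_swap. Qed.

Lemma deg_swapr x y u : x \in A -> y \in B ->
  dg (x |: B :\ y) u + e u y = dg B u + e u x.
Proof.
move=> xA yB; apply: deg_in_swap => //.
by rewrite state_memr xA.
Qed.

Lemma deficientl_exists : exists x, lowA A x.
Proof.
have [x xA lt] := poorP _ _ _ (es_poorl ES PAB) A (subxx A) (es_n0l ES PAB).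
by exists x; rewrite /deficient xA.
Qed.

Lemma deficientr_exists : exists y, lowB B y.
Proof.
have [x xA lt] := poorP _ _ _ (es_poorr ES PAB) B (subxx B) (es_n0r ES PAB).
by exists x; rewrite /deficient xA.
Qed.

(** All deficient vertices of one side are adjacent to all those of the other, so
    two on each side would span a 4-cycle. *)
Lemma deficientr_unique x1 x2 y y' :
  x1 != x2 -> lowA A x1 -> lowA A x2 -> lowB B y -> lowB B y' -> y' = y.
Proof.
move=> x12 lx1 lx2 ly ly'.
have [x1y _ _ _] := es_swap ES PAB lx1 ly.
have [x2y _ _ _] := es_swap ES PAB lx2 ly.
have [x1y' _ _ _] := es_swap ES PAB lx1 ly'.
have [x2y' _ _ _] := es_swap ES PAB lx2 ly'.
exact: e_uc x12 _ _ _ _.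
Qed.

Lemma tight_neighbour_of_deficientr y :
    lowB B y -> (forall y', lowB B y' -> y' = y) ->
  exists2 v, tightB B v & e v y.
Proof.
move=> ly uniq_y; have [x lx] := deficientl_exists.
have [_ _ dy _] := es_swap ES PAB lx ly; have ge2 := es_ge2r ES y.
have [yB _] := andP ly.
have [|||v [s []]] := poor_tight_vertex (es_poorr ES PAB) (R := [set y]).
- have /deg_in_gt0[s sB ys] : 0 < dg B y by deg_lia.
  apply/set0Pn; exists s; rewrite !inE sB andbT eq_sym.
  exact: adj_neq ys.
- by move=> t tB lt; rewrite inE; apply/eqP/uniq_y; rewrite /deficient tB.
- by move=> t r s _; rewrite !inE => /andP[_ /eqP->] /andP[_ /eqP->].
rewrite !inE => /andP[_ vB] /andP[_ /eqP->] vy dv.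
by exists v => //; rewrite /tight vB dv /=.
Qed.

(** Swapping x with y makes y deficient in its new side, and makes v deficient
    because it has lost y and not gained x; swapping y back with v exchanges x
    for v. *)
Lemma exchange_through x y v :
    lowA A x -> lowB B y -> tightB B v -> e v y -> ~~ e v x ->
  [/\ P (v |: A :\ x) (x |: B :\ v),
      lowA (y |: A :\ x) y & lowB (x |: B :\ y) v].
Proof.
move=> lx ly tv vy vx; have [xy dx dy PAB'] := es_swap ES PAB lx ly.
have [xA _] := andP lx; have [yB _] := andP ly; have [vB /eqP dv] := andP tv.
have vny : v != y by apply: adj_neq vy.
have vnx : v != x by rewrite eq_sym state_neq.
have xny : x != y by rewrite state_neq.
have yA : y \notin A by rewrite -state_memr.
have ly' : lowA (y |: A :\ x) y.
  rewrite /deficient !inE eqxx /=.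
  have := deg_swapl y xA yB; have := es_deg ES y PAB.
  by rewrite (adj_irr e_simple) (esym y) xy; deg_lia.
have lv' : lowB (x |: B :\ y) v.
  rewrite /deficient !inE vny vB orbT /=.
  by have := deg_swapr v xA yB; rewrite vy (negPf vx); have := es_ge2r ES v; deg_lia.
split=> //; have [_ _ _] := es_swap ES PAB' ly' lv'.
rewrite setU1K ?inE ?negb_and ?yA ?orbT //.
congr (P _ _); apply/setP => w; rewrite !inE.
case: (eqVneq w y) => [-> | _] /=; first by rewrite yB [y == v]eq_sym vny orbT.
by case: (eqVneq w x) => [-> | _] //=; rewrite eq_sym vnx.
Qed.

(** Otherwise swapping x and y would make u deficient on one side and v on the
    other, hence adjacent, and u v y x would be a 4-cycle. *)
Lemma tight_neighbour_common_of_free x y v u :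
    lowA A x -> lowB B y -> tightB B v -> e v y -> ~~ e v x ->
    tightA A u -> e u x -> e u y.
Proof.
move=> lx ly tv vy vx tu ux; apply/negPn/negP => uy.
have [xA _] := andP lx; have [yB _] := andP ly; have [vB _] := andP tv.
have [uA /eqP du] := andP tu.
have [xy _ _ PAB'] := es_swap ES PAB lx ly.
have [_ _ lv'] := exchange_through lx ly tv vy vx.
have lu' : lowA (y |: A :\ x) u.
  rewrite /deficient !inE uA (adj_neq e_simple ux) orbT /=.
  by have := deg_swapl u xA yB; rewrite ux (negPf uy); deg_lia.
have [uv _ _ _] := es_swap ES PAB' lu' lv'.
have /negP[] := state_neq uA yB; apply/eqP.
by apply: e_uc (state_neq xA vB) _ _ _ _; rewrite // esym.
Qed.

(** Take a tight neighbour v of y; it misses one of x1 and x2, say x1.  If x1 and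
    x2 were adjacent, then after swapping x1 and y both x2 and v would be
    deficient, and x1 x2 v y would be a 4-cycle. *)
Lemma deficientl_indep x1 x2 y :
  x1 != x2 -> lowA A x1 -> lowA A x2 -> lowB B y -> ~~ e x1 x2.
Proof.
wlog: x1 x2 / exists v, [/\ tightB B v, e v y & ~~ e v x1].
  move=> IH x12 lx1 lx2 ly; have uy := deficientr_unique x12 lx1 lx2 ly.
  have [v tv vy] := tight_neighbour_of_deficientr ly uy.
  have [vx1 | ] := boolP (e v x1); last by move=> ?; apply: IH => //; exists v.
  have [vx2 | ] := boolP (e v x2); last first.
    by move=> ?; rewrite esym; apply: IH => //; [exists v | rewrite eq_sym].
  have [x1y _ _ _] := es_swap ES PAB lx1 ly.
  have [x2y _ _ _] := es_swap ES PAB lx2 ly.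
  have Evy : v = y by apply: e_uc x12 _ _ _ _; rewrite // esym.
  by move: vy; rewrite Evy (adj_irr e_simple).
move=> [v [tv vy vx1]] x12 lx1 lx2 ly; apply/negP => ex12.
have [x1y _ _ PAB'] := es_swap ES PAB lx1 ly.
have [x2y dx2 _ _] := es_swap ES PAB lx2 ly.
have [x1A _] := andP lx1; have [yB _] := andP ly; have [vB _] := andP tv.
have [x2A _] := andP lx2.
have [_ _ lv'] := exchange_through lx1 ly tv vy vx1.
have lx2' : lowA (y |: A :\ x1) x2.
  rewrite /deficient !inE x2A [x2 == x1]eq_sym x12 orbT /=.
  by have := deg_swapl x2 x1A yB; rewrite x2y esym ex12; deg_lia.
have [x2v _ _ _] := es_swap ES PAB' lx2' lv'.
have x1Nv := state_neq x1A vB.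
have E : x2 = y by apply: e_uc x1Nv _ _ _ _; rewrite // esym.
by have := state_neq x2A yB; rewrite E eqxx.
Qed.

(** Delete from B the vertex y and its tight neighbours.  The vertex t thus
    exposed has lost one neighbour only, and this neighbour is not y, for else t
    itself would have been deleted. *)
Lemma tight_pendant y :
    lowB B y -> (forall y', lowB B y' -> y' = y) ->
    (forall v u, tightB B v -> e v y -> u \in B -> e u y -> ~~ e v u) ->
  exists v t, [/\ tightB B v, e v y, tightB B t, e t v & ~~ e t y].
Proof.
move=> ly uniq_y indep; have [yB _] := andP ly.
have [v tv vy] := tight_neighbour_of_deficientr ly uniq_y.
have [vB /eqP dv] := andP tv.
pose R := [set w | (w == y) || (tightB B w && e w y)].
have [|||t [r []]] := poor_tight_vertex (es_poorr ES PAB) (R := R).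
- have /deg_in_gt0[s] : 0 < dg (B :\ y) v.
    by have := deg_in_D1 e v yB; rewrite vy; have := es_ge2r ES v; deg_lia.
  rewrite !inE => /andP[sy sB] vs; apply/set0Pn; exists s.
  rewrite !inE sB (negPf sy) /= andbT negb_and orbC.
  by apply/orP; left; apply: contraL vs => sy'; apply: indep.
- by move=> t tB lt; rewrite !inE (uniq_y t) ?eqxx // /deficient tB.
- move=> t r s; rewrite !inE negb_or => /andP[/andP[tNy _] tB].
  move=> /andP[rB rR] /andP[sB sR] tr ts.
  case/orP: rR => [/eqP Er | /andP[tightr ry]];
    case/orP: sR => [/eqP Es | /andP[tights sy]].
  + by rewrite Er Es.
  + by have := indep s t tights sy tB; rewrite -Er (esym s) ts => /(_ tr).
  + by have := indep r t tightr ry tB; rewrite -Es (esym r) tr => /(_ ts).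
  by apply: e_uc tNy _ _ _ _ => //; rewrite esym.
rewrite !inE negb_or => /andP[/andP[tNy tR] tB] /andP[rB rR] tr dt.
have tt : tightB B t by rewrite /tight tB dt /=.
have ty : ~~ e t y by move: tR; rewrite tt.
case/orP: rR => [/eqP Er | /andP[tightr ry]]; first by rewrite -Er tr in ty.
by exists r, t.
Qed.

End State.

End Exchange.

(** * Nets *)

(** A triangle p q r with a pendant edge at each of its vertices, in the position
    where p is the centre of a star of deficient vertices of the other side:
    every vertex is deficient or tight, so that swaps rearrange the net. *)
Record net (V : finType) (e : rel V) (a b : V -> nat)
    (P : {set V} -> {set V} -> Prop) (A B : {set V}) (p q r p1 q1 r1 : V) :
    Prop := Net {
  net_state : P A B;
  net_q : deficient e a A q;
  net_p1 : deficient e a A p1;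
  net_q1 : tight e a A q1;
  net_p : deficient e b B p;
  net_r : tight e b B r;
  net_r1 : tight e b B r1;
  net_pq : e p q;
  net_qr : e q r;
  net_rp : e r p;
  net_pp1 : e p p1;
  net_qq1 : e q q1;
  net_rr1 : e r r1;
  net_p1_neq_q : p1 != q }.

Definition net_set (V : finType) (p q r p1 q1 r1 : V) : {set V} :=
  [set p; q; r; p1; q1; r1].

Section NetGraph.

Variables (V : finType) (e : rel V).
Hypotheses (e_simple : simple_graph e) (e_uc : unique_common_nbr e).
Local Notation esym := (adj_sym e_simple).

Lemma pendant_nonadj_triangle p q r p1 :
  e p q -> e q r -> e r p -> e p p1 -> p1 != r -> ~~ e p1 q.
Proof.
move=> pq qr rp pp1 p1r; apply: contra p1r => p1q; apply/eqP.
by apply: e_uc (adj_neq e_simple pq) _ _ _ _; rewrite // esym.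
Qed.

Lemma pendants_nonadj p q p1 q1 :
  e p q -> e p p1 -> e q q1 -> p1 != q -> q1 != p -> ~~ e p1 q1.
Proof.
move=> pq pp1 qq1 p1q; apply: contra => p1q1; apply/eqP.
by apply: e_uc p1q _ _ _ _; rewrite // esym.
Qed.

Lemma outside_adj_triangle p q r q1 r1 z :
    e p q -> e q r -> e r p -> e q q1 -> e r r1 -> q1 != p -> r1 != p ->
    z != q -> z != r -> e z p ->
  [|| e z r, e z r1 | e z q1] = false.
Proof.
move=> pq qr rp qq1 rr1 q1p r1p zq zr zp; apply/negP => /or3P[zr' | zr1 | zq1].
- have /negP[] := zq; apply/eqP.
  apply: e_uc (adj_neq e_simple rp) _ _ _ _; rewrite // esym //.
- by have /negP[] := r1p; apply/eqP; apply: e_uc zr _ _ _ _.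
by have /negP[] := q1p; apply/eqP; apply: e_uc zq _ _ _ _; rewrite // esym.
Qed.

Lemma deg_in_setD (A M : {set V}) z :
  (forall w, w \in A -> w \in M -> ~~ e z w) ->
  degree_in e A z = degree_in e (A :\: M) z.
Proof.
move=> zM; apply: eq_card => w; rewrite !inE.
case wA: (w \in A); rewrite ?andbF //=.
by case wM: (w \in M) => //=; apply: negbTE; apply: zM.
Qed.

Lemma swap_setD (A M : {set V}) x y :
  x \in M -> y \in M -> (y |: A :\ x) :\: M = A :\: M.
Proof.
move=> xM yM; apply/setP => w; rewrite !inE.
case: (eqVneq w y) => [-> | _]; first by rewrite yM.
by case: (eqVneq w x) => [-> | _]; first by rewrite xM.
Qed.

End NetGraph.

Section Net.

Variables (V : finType) (e : rel V) (a b : V -> nat).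
Variable P : {set V} -> {set V} -> Prop.
Hypotheses (e_simple : simple_graph e) (e_uc : unique_common_nbr e).
Hypothesis ES : exchange_system e a b P.

Local Notation dg := (degree_in e).
Local Notation esym := (adj_sym e_simple).

Section NetState.

Variables (A B : {set V}) (p q r p1 q1 r1 : V).
Hypothesis N : net e a b P A B p q r p1 q1 r1.

Let PAB := net_state N.
Let qA : q \in A. Proof. by case/andP: (net_q N). Qed.
Let p1A : p1 \in A. Proof. by case/andP: (net_p1 N). Qed.
Let q1A : q1 \in A. Proof. by case/andP: (net_q1 N). Qed.
Let pB : p \in B. Proof. by case/andP: (net_p N). Qed.
Let rB : r \in B. Proof. by case/andP: (net_r N). Qed.
Let r1B : r1 \in B. Proof. by case/andP: (net_r1 N). Qed.
Let neqAB := state_neq ES PAB.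

Let dq : dg A q + 1 = a q.
Proof. by have [] := es_swap ES PAB (net_q N) (net_p N). Qed.
Let dp1 : dg A p1 + 1 = a p1.
Proof. by have [] := es_swap ES PAB (net_p1 N) (net_p N). Qed.
Let dp : dg B p + 1 = b p.
Proof. by have [] := es_swap ES PAB (net_q N) (net_p N). Qed.
Let dq1 : dg A q1 = a q1. Proof. by case/andP: (net_q1 N) => _ /eqP. Qed.
Let dr : dg B r = b r. Proof. by case/andP: (net_r N) => _ /eqP. Qed.
Let dr1 : dg B r1 = b r1. Proof. by case/andP: (net_r1 N) => _ /eqP. Qed.

Let pq := net_pq N.
Let qr := net_qr N.
Let rp := net_rp N.
Let pp1 := net_pp1 N.
Let qq1 := net_qq1 N.
Let rr1 := net_rr1 N.
Let qp : e q p. Proof. by rewrite esym. Qed.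
Let rq : e r q. Proof. by rewrite esym. Qed.
Let pr : e p r. Proof. by rewrite esym. Qed.
Let p1p : e p1 p. Proof. by rewrite esym. Qed.
Let q1q : e q1 q. Proof. by rewrite esym. Qed.
Let r1r : e r1 r. Proof. by rewrite esym. Qed.

Lemma net_p_neq_r1 : p != r1.
Proof. by apply/eqP => E; move: dp; rewrite E dr1; deg_lia. Qed.

Lemma net_p1_neq_q1 : p1 != q1.
Proof. by apply/eqP => E; move: dp1; rewrite E dq1; deg_lia. Qed.

Let r1p : r1 != p. Proof. by rewrite eq_sym net_p_neq_r1. Qed.
Let q1p : q1 != p. Proof. exact: neqAB. Qed.

Let p1q' : e p1 q = false.
Proof.
apply: negbTE; apply: pendant_nonadj_triangle pq qr rp pp1 _ => //.
by apply: neqAB.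
Qed.
Let p1r' : e p1 r = false.
Proof.
apply: negbTE; apply: pendant_nonadj_triangle pr rq qp pp1 _ => //.
exact: net_p1_neq_q N.
Qed.
Let q1p' : e q1 p = false.
Proof.
apply: negbTE; apply: pendant_nonadj_triangle qp pr rq qq1 _ => //.
by apply: neqAB.
Qed.
Let r1p' : e r1 p = false.
Proof.
apply: negbTE; apply: pendant_nonadj_triangle rp pq qr rr1 _ => //.
by rewrite eq_sym; apply: neqAB.
Qed.
Let r1q' : e r1 q = false.
Proof. by apply: negbTE; apply: pendant_nonadj_triangle rq qp pr rr1 _. Qed.
Let p1q1' : e p1 q1 = false.
Proof.
apply: negbTE; apply: pendants_nonadj pq pp1 qq1 _ _ => //.
exact: net_p1_neq_q N.
Qed.
Let p1r1' : e p1 r1 = false.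
Proof.
apply: negbTE; apply: pendants_nonadj pr pp1 rr1 _ _ => //.
by apply: neqAB.
Qed.

(** The two swaps below generate all permutations of the triangle, and the
    exchange of the two sides of the partition. *)
Lemma net_swap_qp :
  net e a b P (p |: A :\ q) (q |: B :\ p) q p r q1 p1 r1.
Proof.
have [_ _ _ PAB'] := es_swap ES PAB (net_q N) (net_p N).
have dA u := deg_swapl ES PAB u qA pB; have dB u := deg_swapr ES PAB u qA pB.
split=> //; rewrite ?/deficient ?/tight ?inE ?eqxx //=.
- have := dA p; have := es_deg ES p PAB.
  by rewrite (adj_irr e_simple) pq; deg_lia.
- rewrite q1A andbT (adj_neq e_simple q1q) orbT /=.
  by have := dA q1; rewrite q1q q1p'; deg_lia.
- rewrite p1A (net_p1_neq_q N) orbT /=.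
  by have := dA p1; rewrite p1q' p1p; deg_lia.
- have := dB q; have := es_deg ES q PAB.
  by rewrite (adj_irr e_simple) qp; deg_lia.
- rewrite rB (adj_neq e_simple rp) orbT /=.
  by have := dB r; rewrite rp rq; deg_lia.
by rewrite r1B r1p orbT /=; have := dB r1; rewrite r1p' r1q'; deg_lia.
Qed.

Lemma net_swap_p1p :
  net e b a (fun A B => P B A) (p1 |: B :\ p) (p |: A :\ p1) p r q p1 r1 q1.
Proof.
have [_ _ _ PAB'] := es_swap ES PAB (net_p1 N) (net_p N).
have dA u := deg_swapl ES PAB u p1A pB; have dB u := deg_swapr ES PAB u p1A pB.
split=> //; rewrite ?/deficient ?/tight ?inE ?eqxx //=.
- rewrite rB (adj_neq e_simple rp) orbT /=.
  by have := dB r; rewrite rp (esym r) p1r'; deg_lia.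
- have := dB p1; have := es_deg ES p1 PAB.
  by rewrite (adj_irr e_simple) p1p; deg_lia.
- rewrite r1B r1p orbT /=.
  by have := dB r1; rewrite r1p' (esym r1) p1r1'; deg_lia.
- have := dA p; have := es_deg ES p PAB.
  by rewrite (adj_irr e_simple) pp1; deg_lia.
- rewrite qA [q == p1]eq_sym (net_p1_neq_q N) orbT /=.
  by have := dA q; rewrite qp (esym q p1) p1q'; deg_lia.
- rewrite q1A [q1 == p1]eq_sym net_p1_neq_q1 orbT /=.
  by have := dA q1; rewrite q1p' (esym q1 p1) p1q1'; deg_lia.
exact: neqAB.
Qed.

(** A third deficient vertex z of A would remain deficient when p1 is exchanged
    for r through p, and r1 would become deficient, so z p r r1 would be a
    4-cycle. *)
Lemma net_deficientl z : deficient e a A z -> z != q -> z = p1.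
Proof.
move=> lz zq; apply/eqP/negPn/negP => zp1.
have [zp dz _ _] := es_swap ES PAB lz (net_p N); have [zA _] := andP lz.
have zr' : e z r = false.
  apply: contraNF zq => zr; apply/eqP.
  by apply: e_uc (adj_neq e_simple rp) _ _ _ _; rewrite // esym.
have rp1 : ~~ e r p1 by rewrite esym p1r'.
have [PAB' _ _] :=
  exchange_through e_simple ES PAB (net_p1 N) (net_p N) (net_r N) rp rp1.
have dA u := deg_swapl ES PAB u p1A rB; have dB u := deg_swapr ES PAB u p1A rB.
have lz' : deficient e a (r |: A :\ p1) z.
  rewrite /deficient !inE zp1 zA orbT /=.
  by have := dA z; rewrite zr'; deg_lia.
have lr1 : deficient e b (p1 |: B :\ r) r1.
  rewrite /deficient !inE r1B (adj_neq e_simple r1r) orbT /=.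
  by have := dB r1; rewrite r1r (esym r1) p1r1'; deg_lia.
have [zr1 _ _ _] := es_swap ES PAB' lz' lr1.
have /negP[] := r1p; apply/eqP.
exact: e_uc (neqAB zA rB) _ _ _ _.
Qed.

Local Notation M := (net_set p q r p1 q1 r1).

Let notA w : w \in B -> (w \in A) = false.
Proof. by rewrite (state_memr ES PAB) => /negPf. Qed.
Let notB w : w \in A -> (w \in B) = false.
Proof. by rewrite (state_memr ES PAB) => ->. Qed.

(** Since z is not deficient in A, it must have neighbours in A inside the net. *)
Lemma net_adj_partl z : z \in A :\: M -> dg (A :\: M) z < a z ->
  [|| e z q, e z q1 | e z p1].
Proof.
move=> zAM; apply: contraTT; rewrite !negb_or -leqNgt => /and3P[zq zq1 zp1].
rewrite -(@deg_in_setD _ e A M z).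
  rewrite leqNgt; apply/negP => lz.
  have [zA zM] : z \in A /\ z \notin M by move: zAM; rewrite inE => /andP[].
  have Ez : z = p1.
    apply: net_deficientl; rewrite /deficient ?zA //.
    by apply: contraNneq zM => ->; rewrite !inE eqxx ?orbT.
  by move: zM; rewrite Ez !inE eqxx ?orbT.
move=> w wA; rewrite !inE -!orbA.
by case/or4P=> [|||/or3P[]] /eqP Ew; rewrite Ew // in wA *;
  rewrite notA in wA.
Qed.

Lemma net_adj_partr z : z \in B :\: M -> dg (B :\: M) z < b z ->
  [|| e z p, e z r | e z r1].
Proof.
move=> zBM; apply: contraTT; rewrite !negb_or -leqNgt => /and3P[zp zr zr1].
rewrite -(@deg_in_setD _ e B M z).
  rewrite leqNgt; apply/negP => lz.
  have [zB zM] : z \in B /\ z \notin M by move: zBM; rewrite inE => /andP[].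
  have Ez : z = p.
    apply: (deficientr_unique e_uc ES PAB (net_p1_neq_q N) (net_p1 N)
      (net_q N) (net_p N)).
    by rewrite /deficient zB.
  by move: zM; rewrite Ez !inE eqxx ?orbT.
move=> w wB; rewrite !inE -!orbA.
by case/or4P=> [|||/or3P[]] /eqP Ew; rewrite Ew // in wB *;
  rewrite notB in wB.
Qed.

Lemma net_core_low : exists2 z, z \in A :\: M & dg (A :\: M) z < a z.
Proof.
apply: (poorP _ _ _ (es_poorl ES PAB)); first exact: subsetDl.
have /deg_in_gt0[s sA p1s] : 0 < dg A p1.
  by have := es_ge2l ES p1; deg_lia.
apply/set0Pn; exists s; rewrite !inE sA andbT -!orbA.
have sNp w : e p1 w = false -> s == w = false.
  by move=> p1w; apply/eqP => Es; rewrite Es p1w in p1s.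
have sNB w : w \in B -> s == w = false.
  by move=> wB; apply/eqP => Es; rewrite Es notA in sA.
by rewrite (sNB p) // (sNB r) // (sNB r1) // 
  (sNp q) // (sNp q1) // (sNp p1) ?(adj_irr e_simple).
Qed.

End NetState.

End Net.

Lemma net_set_turn (V : finType) (p q r p1 q1 r1 : V) :
  net_set q r p q1 r1 p1 = net_set p q r p1 q1 r1.
Proof.
apply/setP => w; rewrite !inE.
by do 6!case: (_ == _).
Qed.

Section NetFalse.

Variables (V : finType) (e : rel V).
Hypotheses (e_simple : simple_graph e) (e_uc : unique_common_nbr e).
Local Notation dg := (degree_in e).
Local Notation esym := (adj_sym e_simple).

(** Composing the two generating swaps rotates the net by one step and exchanges
    the roles of the sides. *)
Lemma net_turn a b P A B p q r p1 q1 r1 :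
    exchange_system e a b P -> net e a b P A B p q r p1 q1 r1 ->
  exists A1 B1, [/\ net e b a (fun A B => P B A) B1 A1 q r p q1 r1 p1,
    A1 :\: net_set p q r p1 q1 r1 = A :\: net_set p q r p1 q1 r1
  & B1 :\: net_set p q r p1 q1 r1 = B :\: net_set p q r p1 q1 r1].
Proof.
move=> ES N; have N1 := net_swap_qp e_simple e_uc ES N.
have N2 := net_swap_p1p e_simple e_uc ES N1.
do 2!eexists; split; first exact: N2.
  by rewrite !swap_setD // !inE eqxx ?orbT.
by rewrite !swap_setD // !inE eqxx ?orbT.
Qed.

Lemma net_turn2 a b P A B p q r p1 q1 r1 :
    exchange_system e a b P -> net e a b P A B p q r p1 q1 r1 ->
  exists A1 B1, net e a b P A1 B1 r p q r1 p1 q1 /\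
    A1 :\: net_set p q r p1 q1 r1 = A :\: net_set p q r p1 q1 r1.
Proof.
move=> ES N; have [A1 [B1 [N1 EA _]]] := net_turn ES N.
have [B2 [A2 [N2 _]]] := net_turn (exchange_system_sym e_simple ES) N1.
by rewrite net_set_turn EA; exists A2, B2.
Qed.

Lemma net_adj_parts a b P A B p q r p1 q1 r1 z :
    exchange_system e a b P -> net e a b P A B p q r p1 q1 r1 ->
    z \in A :\: net_set p q r p1 q1 r1 -> dg (A :\: net_set p q r p1 q1 r1) z < a z ->
  [|| e z q, e z q1 | e z p1] /\ [|| e z q, e z p | e z p1].
Proof.
move=> ES N zAM lz; split; first exact: (net_adj_partl e_simple e_uc ES N zAM lz).
have [A1 [B1 [N1 EA _]]] := net_turn ES N.
have ES' := exchange_system_sym e_simple ES.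
by apply: (net_adj_partr e_uc ES' N1); rewrite net_set_turn EA.
Qed.

(** The vertex z has a neighbour in the A-part of the net in each of its
    positions.  If z were adjacent to a vertex of the triangle, C4-freeness would
    leave it no further neighbour but the pendant one there, and some position
    avoids both; with neighbours among the pendant vertices only, the positions
    whose A-part has a single pendant vertex force all three. *)
Lemma net_common_neighbour a b P A B p q r p1 q1 r1 :
    exchange_system e a b P -> net e a b P A B p q r p1 q1 r1 ->
  exists2 z, z \in A :\: net_set p q r p1 q1 r1 & [&& e z p1, e z q1 & e z r1].
Proof.
move=> ES N; have [z zAM lz] := net_core_low e_simple e_uc ES N.
exists z => //.
have [h1 h2] := net_adj_parts ES N zAM lz.
have [A1 [B1 [N1 EA1]]] := net_turn2 ES N.
have [A2 [B2 [N2 EA2]]] := net_turn2 ES N1.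
have E1 := net_set_turn r p q r1 p1 q1.
have [h3 h4] : [|| e z p, e z p1 | e z r1] /\ [|| e z p, e z r | e z r1].
  by apply: (net_adj_parts ES N1); rewrite -E1 EA1.
have [h5 h6] : [|| e z r, e z r1 | e z q1] /\ [|| e z r, e z q | e z q1].
  apply: (net_adj_parts ES N2); rewrite net_set_turn.
    by rewrite E1 EA2 -E1 EA1.
  by rewrite E1 EA2 -E1 EA1.
have zM : z \notin net_set p q r p1 q1 r1 by move: zAM; rewrite inE => /andP[].
move: zM; rewrite !inE !negb_or -!andbA => /and5P[zp zq zr _ _].
have PAB := net_state N.
have neqAB := state_neq ES PAB.
have [qA _] := andP (net_q N); have [p1A _] := andP (net_p1 N).
have [q1A _] := andP (net_q1 N).
have [pB _] := andP (net_p N); have [rB _] := andP (net_r N).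
have [r1B _] := andP (net_r1 N).
have r1p : r1 != p by rewrite eq_sym; exact: (net_p_neq_r1 ES N).
have [pq qr rp] := And3 (net_pq N) (net_qr N) (net_rp N).
have [pp1 qq1 rr1] := And3 (net_pp1 N) (net_qq1 N) (net_rr1 N).
have zp' : e z p = false.
  apply/negP => zp'; move: h5.
  by rewrite (outside_adj_triangle e_simple e_uc pq qr rp qq1 rr1) // neqAB.
have zq' : e z q = false.
  apply/negP => zq'; move: h3.
  rewrite (outside_adj_triangle e_simple e_uc qr rp pq rr1 pp1) //.
    by rewrite eq_sym neqAB.
  exact: net_p1_neq_q N.
have zr' : e z r = false.
  apply/negP => zr'; move: h1.
  by rewrite (outside_adj_triangle e_simple e_uc rp pq qr pp1 qq1) // neqAB.
by move: h2 h4 h6; rewrite zp' zq' zr' /= => -> -> ->.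
Qed.

Lemma net_false a b P A B p q r p1 q1 r1 :
  exchange_system e a b P -> net e a b P A B p q r p1 q1 r1 -> False.
Proof.
move=> ES N; have [A1 [B1 [N1 _ EB]]] := net_turn ES N.
have [z] := net_common_neighbour ES N.
rewrite inE => /andP[_ zA] /and3P[zp1 zq1 _].
have [t] := net_common_neighbour (exchange_system_sym e_simple ES) N1.
rewrite net_set_turn EB inE => /andP[_ tB] /and3P[tq1 _ tp1].
have /negP[] := net_p1_neq_q1 ES N; apply/eqP.
by apply: (e_uc (state_neq ES (net_state N) zA tB)).
Qed.

End NetFalse.

(** * At most one deficient vertex on each side *)

Section Deficient.

Variables (V : finType) (e : rel V).
Hypotheses (e_simple : simple_graph e) (e_uc : unique_common_nbr e).
Local Notation dg := (degree_in e).
Local Notation esym := (adj_sym e_simple).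

(** In a C4-free graph N(y) induces a matching, and this is the set of vertices of
    its part inside A; the induction for [no_two_deficient] is on its size. *)
Definition matched_nbrs (y : V) (A : {set V}) : {set V} :=
  [set u in A | e u y && [exists w in A, e w y && e u w]].

(** Two deficient vertices in A leave y as the only one in B, and deleting all
    deficient vertices from A exposes a tight vertex u next to some deficient x.
    If u is not adjacent to y, there is a net.  If it is, exchanging x for a
    tight neighbour v of y makes u and v deficient: either this leads to a
    partition with a smaller matched part, or some t in B becomes deficient
    besides y. *)
Lemma no_two_deficient a b P A B x1 x2 y :
    exchange_system e a b P -> P A B -> x1 != x2 ->
    deficient e a A x1 -> deficient e a A x2 -> deficient e b B y -> False.
Proof.
move=> ES; move: {2}_.+1 (ltnSn #|matched_nbrs y A|) => n.
elim: n => // n IH in A B x1 x2 * => le_n PAB x12 lx1 lx2 ly.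
have neqAB := state_neq ES PAB.
have uy y' : deficient e b B y' -> y' = y.
  exact: (deficientr_unique e_uc ES PAB x12 lx1 lx2 ly).
have [yB _] := andP ly.
have lowy x : deficient e a A x -> e x y.
  by move=> lx; have [] := es_swap ES PAB lx ly.
have [u [x [tu lx ux]]] : exists u x, [/\ tight e a A u, deficient e a A x & e u x].
  have [|||u [x []]] :=
      poor_tight_vertex (es_poorl ES PAB) (R := [set x | deficient e a A x]).
  - have [_ dx1 _ _] := es_swap ES PAB lx1 ly; have ge2 := es_ge2l ES x1.
    have /deg_in_gt0[s sA x1s] : 0 < dg A x1 by deg_lia.
    apply/set0Pn; exists s; rewrite !inE sA andbT; apply/negP => ls.
    have x1Ns := adj_neq e_simple x1s.
    by move: x1s; apply/negP; apply: (deficientl_indep e_simple e_uc ES PAB x1Ns lx1 ls ly).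
  - by move=> x xA lx; rewrite inE /deficient xA.
  - move=> t r s; rewrite !inE => /andP[_ tA] /andP[_ lr] /andP[_ ls] tr ts.
    by apply: e_uc (neqAB _ _ tA yB) _ _ _ _; rewrite // esym lowy.
  rewrite !inE => /andP[_ uA] /andP[_ lx] ux du.
  by exists u, x; split; rewrite // /tight uA du /=.
have [uA /eqP du] := andP tu; have [xA _] := andP lx.
have xy := lowy x lx; have yx : e y x by rewrite esym.
have xu : e x u by rewrite esym.
have dA w v := deg_swapl ES PAB w xA (y := v).
have dB w v := deg_swapr ES PAB w xA (y := v).
have exch v : e u y -> tight e b B v -> e v y -> e u v = false ->
    [/\ P (v |: A :\ x) (x |: B :\ v), deficient e a (v |: A :\ x) v,
        deficient e a (v |: A :\ x) u & deficient e b (x |: B :\ v) y].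
  move=> uyy tv vy uv; have [vB /eqP dv] := andP tv.
  have vx : e v x = false.
    (* otherwise u and v are two common neighbours of x and y *)
    apply/negP => vx; have /negP[] := neqAB _ _ uA vB; apply/eqP.
    by apply: e_uc (neqAB _ _ xA yB) _ _ _ _; rewrite // esym.
  have [PAB' _ _] := exchange_through e_simple ES PAB lx ly tv vy (negbT vx).
  split=> //; rewrite /deficient !inE ?eqxx /=.
  - have := dA v v vB; have := es_deg ES v PAB.
    by rewrite (adj_irr e_simple) vx; deg_lia.
  - rewrite uA (adj_neq e_simple ux) orbT /=.
    by have := dA u v vB; rewrite ux uv; deg_lia.
  rewrite yB [y == v]eq_sym (adj_neq e_simple vy) orbT /=.
  have [_ _ dy _] := es_swap ES PAB lx ly.
  by have := dB y v vB; rewrite yx (esym y v) vy; deg_lia.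
have [uyy | /negPf uyN] := boolP (e u y); last first.
  (* Here every tight neighbour of y sees x, so x v y is the triangle of a net. *)
  have allx v : tight e b B v -> e v y -> e v x.
    move=> tv vy; apply/negPn/negP => vx; move/negP: uyN; case.
    by apply: (tight_neighbour_common_of_free e_simple e_uc ES PAB lx ly tv vy vx tu ux).
  have [|v [t [tv vy tt tv' _]]] := tight_pendant e_simple e_uc ES PAB ly uy.
    move=> v w tv vy wB wy; apply/negP => vw.
    have /negP[] := neqAB _ _ xA wB; apply/eqP.
    have vx := allx v tv vy.
    by apply: e_uc (adj_neq e_simple vy) _ _ _ _; rewrite // esym.
  have [x' lx' x'x] : exists2 x', deficient e a A x' & x' != x.
    case: (eqVneq x1 x) => [<- | ]; last by exists x1.
    by exists x2 => //; rewrite eq_sym.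
  have xv : e x v by rewrite esym allx.
  have vt : e v t by rewrite esym.
  have yx' : e y x' by rewrite esym lowy.
  by apply: (@net_false _ e e_simple e_uc a b P A B y x v x' u t ES).
have vxN v : v \in B -> e v y -> e u v -> False.
  move=> vB vy uv; have /negP[] := neqAB _ _ xA vB; apply/eqP.
  by apply: e_uc (neqAB _ _ uA yB) _ _ _ _; rewrite // esym.
(* Case of a tight v with no neighbour in N(y) on the side of A: x and u leave
   the matched part, v does not enter it. *)
have [/existsP[v /and3P[tv vy /forall_inP free]] | ] :=
    boolP [exists v, [&& tight e b B v, e v y & [forall w in A, e w y ==> ~~ e v w]]].
  have vw w : w \in A -> e w y -> e v w = false.
    by move=> wA wy; apply/negbTE/(implyP (free w wA)).
  have [vB _] := andP tv.
  have [|PAB' lv' lu' ly'] := exch v uyy tv vy; first by rewrite esym vw.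
  apply: (IH _ _ u v _ PAB' _ lu' lv' ly'); last exact: neqAB.
  apply: leq_trans (proper_card _) le_n; apply/properP; split.
    apply/subsetP => w; rewrite !inE.
    case/andP=> /orP[/eqP-> | /andP[wx wA]] /andP[wy /exists_inP[s]].
      rewrite !inE => /orP[/eqP-> | /andP[_ sA]] /andP[sy vs].
        by rewrite (adj_irr e_simple) in vs.
      by rewrite vw in vs.
    rewrite !inE => /orP[/eqP-> | /andP[_ sA]] /andP[sy ws].
      by rewrite esym vw in ws.
    by rewrite wA wy; apply/exists_inP; exists s; rewrite ?sy.
  exists x; rewrite !inE; last by rewrite (negPf (neqAB _ _ xA vB)) eqxx.
  by rewrite xA xy; apply/exists_inP; exists u; rewrite ?uyy.
(* Now all tight neighbours of y are matched into A, so none is matched in B. *)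
rewrite negb_exists => /forallP noexch.
have [|v [t [tv vy tt tv' ty]]] := tight_pendant e_simple e_uc ES PAB ly uy.
  move=> v w tv vy wB wy; apply/negP => vw.
  have := noexch v; rewrite tv vy /= negb_forall_in => /exists_inP[s sA].
  rewrite negb_imply negbK => /andP[sy vs].
  have /negP[] := neqAB _ _ sA wB; apply/eqP.
  by apply: e_uc (adj_neq e_simple vy) _ _ _ _; rewrite // esym.
have [vB _] := andP tv; have [tB /eqP dt] := andP tt.
have [|PAB' lv' lu' ly'] := exch v uyy tv vy.
  by apply/negP; apply: vxN.
have tNy : t != y.
  by apply/eqP => E; case/andP: ly; rewrite -E dt ltnn.
have tx : e t x = false.
  apply/negP => tx; have /negP[] := neqAB _ _ xA vB; apply/eqP.
  by apply: e_uc tNy _ _ _ _; rewrite // esym.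
have lt' : deficient e b (x |: B :\ v) t.
  rewrite /deficient !inE tB (adj_neq e_simple tv') orbT /=.
  by have := dB t v vB; rewrite tv' tx; deg_lia.
have /negP[] := tNy; apply/eqP.
exact: (deficientr_unique e_uc ES PAB' (neqAB _ _ uA vB) lu' lv' ly' lt').
Qed.

(** Otherwise swapping x and y makes u deficient besides y. *)
Lemma tight_neighbour_common a b P A B x y u :
    exchange_system e a b P -> P A B ->
    deficient e a A x -> deficient e b B y ->
    tight e a A u -> e u x -> e u y.
Proof.
move=> ES PAB lx ly tu ux; apply/negPn/negP => uy.
have [xA _] := andP lx; have [yB _] := andP ly; have [uA /eqP du] := andP tu.
have [xy dx dy PAB'] := es_swap ES PAB lx ly.
have dA w := deg_swapl ES PAB w xA yB; have dB w := deg_swapr ES PAB w xA yB.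
apply: (no_two_deficient (y := x) ES PAB' (state_neq ES PAB uA yB)).
- rewrite /deficient !inE uA (adj_neq e_simple ux) orbT /=.
  by have := dA u; rewrite ux (negPf uy); deg_lia.
- rewrite /deficient !inE eqxx /=.
  have := dA y; have := es_deg ES y PAB.
  by rewrite (adj_irr e_simple) (esym y x) xy; deg_lia.
rewrite /deficient !inE eqxx /=.
have := dB x; have := es_deg ES x PAB.
by rewrite (adj_irr e_simple) xy; deg_lia.
Qed.

(** With a single deficient vertex x in A and y in B, each has a tight neighbour
    on its own side; these are distinct and both adjacent to x and to y. *)
Lemma exchange_system_empty a b P A B :
  exchange_system e a b P -> ~ P A B.
Proof.
move=> ES PAB; have ES' := exchange_system_sym e_simple ES.
have [x lx] := deficientl_exists ES PAB; have [y ly] := deficientr_exists ES PAB.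
have ux x' : deficient e a A x' -> x' = x.
  move=> lx'; apply/eqP/negPn/negP => xx'.
  exact: (no_two_deficient ES PAB xx' lx' lx ly).
have uy y' : deficient e b B y' -> y' = y.
  move=> ly'; apply/eqP/negPn/negP => yy'.
  exact: (no_two_deficient (P := fun A B => P B A) ES' PAB yy' ly' ly lx).
have [v tv vy] := tight_neighbour_of_deficientr e_simple ES PAB ly uy.
have [u tu uxx] :=
  tight_neighbour_of_deficientr e_simple ES' (A := B) (B := A) PAB lx ux.
have vx : e v x.
  exact: (tight_neighbour_common (P := fun A B => P B A) ES' PAB ly lx tv vy).
have uyy : e u y by apply: (tight_neighbour_common ES PAB lx ly tu uxx).
have [xA _] := andP lx; have [yB _] := andP ly.
have [uA _] := andP tu; have [vB _] := andP tv.
have /negP[] := state_neq ES PAB uA vB; apply/eqP.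
by apply: e_uc (state_neq ES PAB xA yB) _ _ _ _; rewrite // esym.
Qed.

End Deficient.

(** * The extremal partitions *)

Section Extremal.

Variables (V : finType) (e : rel V) (a b : V -> nat).
Hypothesis e_simple : simple_graph e.
Hypotheses (a_ge2 : forall x, 2 <= a x) (b_ge2 : forall x, 2 <= b x).
Hypothesis e_deg : forall x, degree e x + 1 = a x + b x.

Local Notation dg := (degree_in e).
Local Notation esym := (adj_sym e_simple).
Local Notation good := (good e).
Local Notation poor := (poor e).

(** Extend S greedily: if the complement of S is not b-good, it contains a vertex
    with fewer than b x neighbours there, hence with at least a x neighbours in
    S, and this vertex is not in T. *)
Lemma good_pair_partition (S T : {set V}) :
    S != set0 -> T != set0 -> [disjoint S & T] -> good a S -> good b T ->
  exists A B : {set V}, [/\ vertex_partition A B, good a A & good b B].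
Proof.
move=> S0 T0 dST gS gT; move: {2}_.+1 (ltnSn #|~: S|) => n.
elim: n => // n IH in S S0 dST gS * => le_n.
have TS : T \subset ~: S by rewrite subsetC -disjoints_subset.
case: (boolP (good b (~: S))) => [gSC | ].
  exists S, (~: S); split=> //; split; rewrite ?setUCr //.
    by apply: contraNneq T0 => E; rewrite -subset0 -E.
  by rewrite disjoints_subset setCK.
rewrite negb_forall_in => /exists_inP[x xS]; rewrite -ltnNge => ltx.
have xT : x \notin T.
  apply: contraTN ltx => xT; rewrite -leqNgt.
  by apply: leq_trans (forall_inP gT x xT) _; apply: deg_inS.
have xNS : x \notin S by move: xS; rewrite inE.
apply: (IH (x |: S)).
- by apply/set0Pn; exists x; rewrite setU11.
- by rewrite disjoints_subset subUset sub1set inE xT -disjoints_subset.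
- apply/forall_inP => w; rewrite !inE => /orP[/eqP-> | wS].
    rewrite deg_in_U1 // (adj_irr e_simple).
    by have := deg_in_setC e S x; have := e_deg x; deg_lia.
  by apply: leq_trans (forall_inP gS w wS) _; apply: deg_inS; apply: subsetUr.
apply: leq_trans (proper_card _) le_n; rewrite properC.
by rewrite properUr // sub1set.
Qed.

(** When d(x) = a(x) + b(x) - 1 for all x, this is, up to a constant, the number of
    edges inside A and inside its complement, plus the sum of b over A and of a
    over the complement. *)
Definition weight (A : {set V}) : nat :=
  \sum_(x in A) dg A x + \sum_(x in ~: A) (2 * a x - 1).

Lemma weight_D1 (A : {set V}) x : x \in A ->
  weight A + 2 * a x = weight (A :\ x) + 2 * dg A x + 1.
Proof.
move=> xA; rewrite /weight (big_setD1 x xA) /=.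
have -> : ~: (A :\ x) = x |: ~: A by rewrite setCD setUC.
rewrite big_setU1 ?inE ?xA //=.
have -> : \sum_(u in A :\ x) dg A u = dg A x + \sum_(u in A :\ x) dg (A :\ x) u.
  rewrite (eq_bigr (fun u => e x u + dg (A :\ x) u)); last first.
    by move=> u _; rewrite (deg_in_D1 e u xA) esym.
  rewrite big_split /=; congr (_ + _).
  rewrite -big_mkcondr /= sum1dep_card (deg_in_D1 e x xA) (adj_irr e_simple).
  by apply: eq_card => u; rewrite !inE.
by have := a_ge2 x; deg_lia.
Qed.

Lemma good_setT : good a setT.
Proof.
apply/forall_inP => x _; have := deg_in_setC e setT x.
rewrite setCT; have -> : dg set0 x = 0 by apply: eq_card0 => y; rewrite !inE.
by have := e_deg x; have := b_ge2 x; deg_lia.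
Qed.

End Extremal.

Section Reduction.

Variables (V : finType) (e : rel V).
Hypothesis e_simple : simple_graph e.
Local Notation dg := (degree_in e).
Local Notation esym := (adj_sym e_simple).

Lemma poor_good_sub a (A R : {set V}) :
  poor e a A -> R != set0 -> R \subset A -> good e a R = false.
Proof.
move=> /forallP/(_ R); case: (good e a R); rewrite ?implybF // => + R0 RA.
by rewrite R0 RA.
Qed.

Lemma not_poorP a (A : {set V}) :
  ~~ poor e a A -> exists R : {set V}, [/\ R \subset A, R != set0 & good e a R].
Proof.
rewrite negb_forall => /existsP[R]; rewrite negb_imply negbK => /andP[/andP[RA R0] gR].
by exists R.
Qed.

(** The vertex x has too small a degree in A, so it owes its degree in the good set
    R to the additional vertex y. *)
Lemma good_through_deficient a (A R : {set V}) x y :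
    y \notin A -> dg A x < a x -> R \subset y |: A -> good e a R -> x \in R ->
  e x y /\ dg A x + 1 = a x.
Proof.
move=> yA lx RA /forall_inP gR xR.
have := leq_trans (gR x xR) (deg_inS e x RA).
by rewrite deg_in_U1 //; case: (e x y) => /=; deg_lia.
Qed.

(** Removing a tight vertex from a minimal a-good set yields two poor sides; the
    family consists of all such partitions of maximum weight.  If x is deficient
    in A, then A without x is still poor and the weight would increase, so B
    with x added contains a good set S; likewise A with y added contains a good
    set R.  They are not disjoint, hence contain x or y in common, and counting
    degrees shows that every such R and S contain both.  In particular neither
    survives the swap of x and y, and the swap preserves the weight. *)
Lemma exchange_system_of_no_good_pair a b :
    (forall x, 2 <= a x) -> (forall x, 2 <= b x) ->
    (forall x, degree e x + 1 = a x + b x) -> 0 < #|V| ->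
    (forall S T : {set V}, S != set0 -> T != set0 -> [disjoint S & T] ->
       good e a S -> good e b T -> False) ->
  exists P A B, exchange_system e a b P /\ P A B.
Proof.
move=> a_ge2 b_ge2 e_deg V_gt0 noST.
have e_deg' x : degree e x + 1 = b x + a x by rewrite e_deg addnC.
have degAC (A : {set V}) x : dg A x + dg (~: A) x + 1 = a x + b x.
  by rewrite deg_in_setC.
have T0 : [set: V] != set0 by rewrite -card_gt0 cardsT.
have poorC (A : {set V}) : A != set0 -> good e a A -> poor e b (~: A).
  move=> A0 gA; apply/forallP => S; apply/implyP => /andP[SA S0].
  apply/negP => gS; apply: (noST A S A0 S0 _ gA gS).
  by rewrite disjoint_sym disjoints_subset.
pose split_ (A : {set V}) := poor e a A && poor e b (~: A).
have [A0 split0] : exists A0, split_ A0.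
  have gT := good_setT b_ge2 e_deg.
  have [|M /andP[M0 gM] minM] :=
      @arg_minnP _ setT [pred A : {set V} | (A != set0) && good e a A] (fun A => #|A|).
    by rewrite /= T0.
  have sub_poor (A : {set V}) : A \proper M -> poor e a A.
    move=> AM; apply/forallP => S; apply/implyP => /andP[SA S0].
    apply/negP => gS; have := minM S; rewrite /= S0 gS => /(_ isT).
    by rewrite leqNgt (proper_card (sub_proper_trans SA AM)).
  have [x xM dx] : exists2 x, x \in M & dg M x = a x.
    have [/exists_inP[x xM /eqP]|] := boolP [exists x in M, dg M x == a x].
      by exists x.
    rewrite negb_exists_in => /forall_inP noeq.
    have [x xM] := set0Pn _ M0.
    have := sub_poor _ (properD1 xM).
    have gt y : y \in M -> a y < dg M y.
      by move=> yM; rewrite ltn_neqAle eq_sym noeq //= (forall_inP gM).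
    have /deg_in_gt0[y yM xy] : 0 < dg M x by apply: leq_ltn_trans (gt x xM).
    suff gMx : good e a (M :\ x).
      rewrite (negbTE (_ : ~~ poor e a (M :\ x))) //.
      apply/negP => /poor_good_sub/(_ _ (subxx _)); rewrite gMx => H.
      have : M :\ x != set0.
        by apply/set0Pn; exists y; rewrite !inE yM eq_sym (adj_neq e_simple xy).
      by move/H.
    apply/forall_inP => w; rewrite !inE => /andP[wx wM].
    have := gt w wM; rewrite (deg_in_D1 e w xM).
    by case: (e w x) => /=; deg_lia.
  exists (M :\ x); rewrite /split_ sub_poor ?properD1 //=.
  rewrite setCD setUC; apply/forallP => S; apply/implyP => /andP[SM S0].
  apply/negP => gS; have poorM := poorC M M0 gM.
  have xMC : x \notin ~: M by rewrite inE xM.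
  have xS : x \in S.
    apply/negPn/negP => xS; have := poor_good_sub poorM S0.
    rewrite gS => H; have : S \subset ~: M by rewrite -(setU1K xMC) subsetD1 SM xS.
    by move/H.
  have := leq_trans (forall_inP gS x xS) (deg_inS e x SM).
  by rewrite deg_in_U1 // (adj_irr e_simple); have := degAC M x; deg_lia.
have [|A splitA maxA] := @arg_maxnP _ A0 [pred A | split_ A] (weight e a).
  exact: split0.
pose P (A B : {set V}) := [/\ B = ~: A, poor e a A, poor e b B
  & forall A', split_ A' -> weight e a A' <= weight e a A].
exists P, A, (~: A); split; last by case/andP: splitA.
split=> //.
- by move=> ? ? [].
- move=> {splitA maxA}A B [-> _ pB _]; apply: contraTneq pB => ->; rewrite setC0.
  apply/negP => pT; have := poor_good_sub pT T0 (subxx _).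
  by rewrite (good_setT a_ge2 e_deg').
- move=> {splitA maxA}A B [-> pA _ _]; apply: contraTneq pA => /(congr1 (@setC V)).
  rewrite setCK setC0 => ->.
  apply/negP => pT; have := poor_good_sub pT T0 (subxx _).
  by rewrite (good_setT b_ge2 e_deg).
- by move=> ? ? [].
- by move=> ? ? [].
- by move=> ? ? ? [-> _ _ _]; apply: degAC.
move=> {splitA maxA}A _ x y [-> pA pB maxA] /andP[xA lx] /andP[yB ly].
have yA : y \notin A by rewrite inE in yB.
have xB : x \notin ~: A by rewrite inE xA.
have xy : x != y by apply: contraNneq yA => <-.
have wx := weight_D1 e_simple a_ge2 xA.
have AxC : ~: (A :\ x) = x |: ~: A by rewrite setCD setUC.
have AyC : ~: (y |: A) = ~: A :\ y by rewrite setCU setIC -setDE.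
have [S [SB S0 gS]] : exists S : {set V},
    [/\ S \subset x |: ~: A, S != set0 & good e b S].
  apply: not_poorP; apply/negP => pxB.
  have := maxA (A :\ x); rewrite /split_ AxC pxB (poorS (subD1set _ _) pA).
  by move=> /(_ isT); deg_lia.
have [R [RA R0 gR]] : exists R : {set V},
    [/\ R \subset y |: A, R != set0 & good e a R].
  apply: not_poorP; apply/negP => pyA.
  have := maxA (y |: A); rewrite /split_ AyC pyA (poorS (subD1set _ _) pB).
  have := weight_D1 e_simple a_ge2 (setU11 y A).
  rewrite setU1K // deg_in_U1 // (adj_irr e_simple).
  by move=> + /(_ isT); have := degAC A y; deg_lia.
have both (R' S' : {set V}) : R' \subset y |: A -> R' != set0 -> good e a R' ->
    S' \subset x |: ~: A -> S' != set0 -> good e b S' ->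
    [/\ e x y, dg A x + 1 = a x, dg (~: A) y + 1 = b y, x \in R' & y \in S'].
  move=> {}RA {}R0 {}gR {}SB {}S0 {}gS.
  have toR := good_through_deficient yA lx RA gR.
  have toS := good_through_deficient xB ly SB gS.
  have xS : x \in S'.
    apply/negPn/negP => xS; have := poor_good_sub pB S0; rewrite gS => H.
    have : S' \subset ~: A by rewrite -(setU1K xB) subsetD1 SB xS.
    by move/H.
  have yR : y \in R'.
    apply/negPn/negP => yR; have := poor_good_sub pA R0; rewrite gR => H.
    have : R' \subset A by rewrite -(setU1K yA) subsetD1 RA yR.
    by move/H.
  have or : (x \in R') || (y \in S').
    apply/negPn/negP; rewrite negb_or => /andP[xR yS].
    apply: (noST _ _ R0 S0 _ gR gS); rewrite disjoint_subset.
    apply/subsetP => w wR; rewrite !inE; apply/negP => wS.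
    have := subsetP RA w wR; have := subsetP SB w wS; rewrite !inE.
    case/orP=> [/eqP E | wA]; first by rewrite -E wR in xR.
    by rewrite (negPf wA) orbF => /eqP E; rewrite -E wS in yS.
  have stepS : x \in R' -> y \in S'.
    move=> /toR[exy dx]; apply/negPn/negP => yS.
    have SB' : S' \subset x |: ~: A :\ y.
      apply/subsetP => w wS; have := subsetP SB w wS; rewrite !inE.
      by case: (eqVneq w y) => [E | //]; rewrite -E wS in yS.
    have := leq_trans (forall_inP gS x xS) (deg_inS e x SB').
    rewrite deg_in_U1 ?inE ?xA ?andbF // (adj_irr e_simple).
    have := degAC A x; rewrite (deg_in_D1 e x yB) exy; deg_lia.
  have stepR : y \in S' -> x \in R'.
    move=> /toS[eyx dy]; apply/negPn/negP => xR.
    have RA' : R' \subset y |: A :\ x.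
      apply/subsetP => w wR; have := subsetP RA w wR; rewrite !inE.
      by case: (eqVneq w x) => [E | //]; rewrite -E wR in xR.
    have := leq_trans (forall_inP gR y yR) (deg_inS e y RA').
    rewrite deg_in_U1 ?inE ?(negPf yA) ?andbF // (adj_irr e_simple).
    have := degAC A y; rewrite (deg_in_D1 e y xA) eyx; deg_lia.
  have xR : x \in R' by case/orP: or.
  have yS := stepS xR; have [exy dx] := toR xR; have [_ dy] := toS yS.
  by split.
have [exy dx dy _ _] := both R S RA R0 gR SB S0 gS.
have CA : ~: (y |: A :\ x) = x |: ~: A :\ y.
  apply/setP => w; rewrite !inE.
  by case: (eqVneq w x) => [->|_]; rewrite ?(negPf xy) //= negb_or.
split=> //; split; first by rewrite CA.
- apply/forallP => R'; apply/implyP => /andP[RA' R0']; apply/negP => gR'.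
  have RAy : R' \subset y |: A.
    by apply: subset_trans RA' _; apply: setUS; apply: subD1set.
  have [_ _ _ xR' _] := both R' S RAy R0' gR' SB S0 gS.
  by have := subsetP RA' x xR'; rewrite !inE eqxx (negPf xy).
- apply/forallP => S'; apply/implyP => /andP[SB' S0']; apply/negP => gS'.
  have SBx : S' \subset x |: ~: A.
    by apply: subset_trans SB' _; apply: setUS; apply: subD1set.
  have [_ _ _ _ yS'] := both R S' RA R0 gR SBx S0' gS'.
  by have := subsetP SB' y yS'; rewrite !inE eqxx [y == x]eq_sym (negPf xy).
move=> A' /maxA; have := weight_D1 e_simple a_ge2 (setU11 y (A :\ x)).
have yAx : y \notin A :\ x by rewrite inE (negPf yA) andbF.
rewrite setU1K // deg_in_U1 // (adj_irr e_simple).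
have := degAC A y; rewrite (deg_in_D1 e y xA) esym exy; deg_lia.
Qed.

End Reduction.

Theorem theorem2 (V : finType) (e : rel V) (a b : V -> nat)
    (V_nonempty : 0 < #|V|) (e_simple : simple_graph e) (e_C4 : C4_free e)
    (a_ge2 : forall x : V, 2 <= a x) (b_ge2 : forall x : V, 2 <= b x)
    (e_deg : forall x : V, a x + b x - 1 <= degree e x) :
  exists A B : {set V},
    [/\ vertex_partition A B,
        forall x : V, x \in A -> a x <= degree_in e A x
      & forall x : V, x \in B -> b x <= degree_in e B x].
Proof.
(* The largest b allowed by the degree condition: it turns it into an equality. *)
pose b' x := degree e x + 1 - a x.
have le_b x : b x <= b' x by have := e_deg x; rewrite /b'; deg_lia.
have b'_ge2 x : 2 <= b' x by apply: leq_trans (le_b x).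
have e_deg' x : degree e x + 1 = a x + b' x.
  by rewrite /b'; have := e_deg x; have := b_ge2 x; deg_lia.
suff [S [T [S0 T0 dST gS gT]]] : exists S T : {set V},
    [/\ S != set0, T != set0, [disjoint S & T], good e a S & good e b' T].
  have [A [B [pAB gA gB]]] := good_pair_partition e_simple e_deg' S0 T0 dST gS gT.
  exists A, B; split=> // x; first exact: (forall_inP gA).
  by move=> xB; apply: leq_trans (le_b x) (forall_inP gB x xB).
pose pair_ok := [pred ST : {set V} * {set V} | [&& ST.1 != set0, ST.2 != set0,
  [disjoint ST.1 & ST.2], good e a ST.1 & good e b' ST.2]].
case: (pickP pair_ok) => [[S T] /and5P[] | noST]; first by exists S, T.
have [||P [A [B [ES PAB]]]] :=
  exchange_system_of_no_good_pair e_simple a_ge2 b'_ge2 e_deg' _.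
- exact: V_nonempty.
- move=> S T S0 T0 dST gS gT; have := noST (S, T).
  by rewrite /= S0 T0 dST gS gT.
case: (exchange_system_empty e_simple _ ES PAB).
exact: C4_free_unique_common_nbr.
Qed.
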